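(* Let $0<k<d$ be integers, let $\mathbf{K}$ be a convex body in $\mathbb{R}^d$, and let $r\ge 1$ be an integer. Let $C_i=B_i+H_i$, $i\le N$, be $k$-codimensional cylinders in $\mathbb{R}^d$ (with $H_i$ a $k$-dimensional linear subspace and $B_i\subset H_i^\perp$ measurable) which form an $r$-fold packing in $\mathbf{K}$, and let $\bar C_i=C_i\cap\mathbf{K}$. Assume that the $\bar C_i$'s are convex bodies in $\mathbb{R}^d$. Then $$\sum_{i=1}^N \mathrm{crv}_{\mathbf{K}}(C_i)\le r\binom{d}{k}\,\max_{i\le N}\,\frac{\max_{x\in\mathbb{R}^d}\mathrm{vol}_k\left(\mathbf{K}\cap(x+H_i)\right)}{\max_{x\in\mathbb{R}^d}\mathrm{vol}_k\left(\bar C_i\cap(x+H_i)\right)} .$$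
   Context: A convex body in $\mathbb{R}^d$ is a compact convex set with non-empty interior. $P_E$ denotes the orthogonal projection onto a linear subspace $E\subset\mathbb{R}^d$, $E^\perp$ the orthogonal complement of $E$, and $\mathrm{vol}_m$ the $m$-dimensional volume. For $0<k<d$, a $k$-codimensional cylinder is a set $C\subset\mathbb{R}^d$ that can be presented in the form $C=B+H$, where $H$ is a $k$-dimensional linear subspace of $\mathbb{R}^d$ and $B$ is a measurable set in $E:=H^\perp$. For a convex body $\mathbf{K}$ in $\mathbb{R}^d$ and a $k$-codimensional cylinder $C=B+H$ with $E=H^\perp$, the crossectional volume of $C$ with respect to $\mathbf{K}$ is $$\mathrm{crv}_{\mathbf{K}}(C)=\frac{\mathrm{vol}_{d-k}(B)}{\mathrm{vol}_{d-k}(P_E\mathbf{K})}.$$ Let $\mathbf{K}$ be a convex body in $\mathbb{R}^d$, let $C_i=B_i+H_i$, $i\le N$, be $k$-codimensional cylinders, $E_i=H_i^\perp$ and $\bar C_i=C_i\cap\mathbf{K}$. The $C_i$'s form an $r$-fold packing in $\mathbf{K}$ if $B_i\subset P_{E_i}\mathbf{K}$ for every $i\le N$ and each point of $\mathbf{K}$ belongs to at most $r$ of the interiors $\mathrm{int}(\bar C_i)$. *)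

(* Defs.v *)
From HB Require Import structures.
From mathcomp Require Import all_boot all_order all_algebra.
From mathcomp Require Import all_classical all_reals all_analysis.

Set Implicit Arguments.
Unset Strict Implicit.
Unset Printing Implicit Defensive.

Import Order.TTheory GRing.Theory Num.Theory.
Import numFieldNormedType.Exports.

Local Open Scope classical_set_scope.
Local Open Scope ring_scope.

Section lebesgue_tuple.
Context {R : realType}.
Local Notation mR := (measurableTypeR R).

Definition cons_pair n (p : mR * n.-tuple mR) : n.+1.-tuple mR :=
  [the n.+1.-tuple mR of p.1 :: p.2].

Lemma measurable_cons_pair n : measurable_fun [set: mR * n.-tuple mR] (@cons_pair n).
Proof. exact: measurable_cons. Qed.

Section cons_measure.
Variables (n : nat) (mu : {sigma_finite_measure set (n.-tuple mR) -> \bar R}).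

Definition cons_measure : set (n.+1.-tuple mR) -> \bar R :=
  pushforward (lebesgue_measure \x mu)%E (@cons_pair n).

Let cons_measure0 : cons_measure set0 = 0%E.
Proof. by rewrite /cons_measure /pushforward preimage_set0 measure0. Qed.

Let cons_measure_ge0 A : (0 <= cons_measure A)%E.
Proof. by rewrite /cons_measure /pushforward; exact: measure_ge0. Qed.

Let cons_measure_sigma_additive : semi_sigma_additive cons_measure.
Proof.
move=> F mF tF mUF; rewrite /cons_measure /pushforward preimage_bigcup.
have mcons := @measurable_cons_pair n.
apply: measure_semi_sigma_additive.
- by move=> i; rewrite -[X in measurable X]setTI; exact: mcons.
- apply/trivIsetP => /= i j _ _ ij; rewrite -preimage_setI.
  by move/trivIsetP : tF => /(_ _ _ _ _ ij) ->//; rewrite preimage_set0.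
- by rewrite -preimage_bigcup -[X in measurable X]setTI; exact: mcons.
Qed.

HB.instance Definition _ := isMeasure.Build _ _ _ cons_measure
  cons_measure0 cons_measure_ge0 cons_measure_sigma_additive.

Let cons_measure_sigma_finite : sigma_finite setT cons_measure.
Proof.
have /sigma_finiteP[F [TF ndF Foo]] := sigma_finiteT (@lebesgue_measure R).
have /sigma_finiteP[G [TG ndG Goo]] := sigma_finiteT mu.
have FT : [set: mR * n.-tuple mR] = \bigcup_i (F i `*` G i).
  rewrite -setXTT TF TG; apply/seteqP; split=> [[x y]|[x y]] /=.
    move=> [[i _ Fix] [j _ Gjy]]; exists (maxn i j) => //; split.
    - by move: x Fix; exact/subsetPset/ndF/leq_maxl.
    - by move: y Gjy; exact/subsetPset/ndG/leq_maxr.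
  by move=> [i _ []/= ? ?]; split; exists i.
pose uncons (t : n.+1.-tuple mR) : mR * n.-tuple mR :=
  (tnth t ord0, [tuple of behead t]).
have unconsK p : uncons (cons_pair p) = p.
  by case: p => x t; congr pair; exact/val_inj.
have muncons : measurable_fun [set: n.+1.-tuple mR] uncons.
  by apply: measurable_fun_pair; [exact: measurable_tnth|exact: measurable_behead].
exists (fun i => uncons @^-1` (F i `*` G i)).
  by rewrite -preimage_bigcup -FT.
move=> i; have [mFi Fioo] := Foo i; have [mGi Gioo] := Goo i; split.
  by rewrite -[X in measurable X]setTI; apply: muncons => //; exact: measurableX.
rewrite /cons_measure /pushforward -comp_preimage.
rewrite (_ : uncons \o _ = id); last by apply/funext => p /=; rewrite unconsK.
by rewrite preimage_id product_measure1E// lte_mul_pinfty// ge0_fin_numE.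
Qed.

HB.instance Definition _ := Measure_isSigmaFinite.Build _ _ _ cons_measure
  cons_measure_sigma_finite.

End cons_measure.

(* The n-fold product of the Lebesgue measure, on the Borel sets of R^n;
   R^0 is a point, of mass 1. *)
Fixpoint lebesgue_tuple n : {sigma_finite_measure set (n.-tuple mR) -> \bar R} :=
  match n with
  | 0 => [the {sigma_finite_measure set (0.-tuple mR) -> \bar R} of
            \d_([tuple] : 0.-tuple mR)]
  | m.+1 => [the {sigma_finite_measure set (m.+1.-tuple mR) -> \bar R} of
               cons_measure (lebesgue_tuple m)]
  end.

(* Lebesgue outer measure; on Lebesgue measurable sets, i.e. those that are
   Caratheodory measurable for it, it is the n-dimensional volume. *)
Definition lebesgue_vol n : set (n.-tuple mR) -> \bar R :=
  ((lebesgue_tuple n)^*)%mu.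

Definition lebesgue_measurable n (A : set (n.-tuple mR)) : Prop :=
  (@lebesgue_vol n).-caratheodory A.

End lebesgue_tuple.

Section euclidean.
Context {R : realType} {d : nat}.
Local Notation V := 'rV[R]_d.

Definition edot (u v : V) : R := (u *m v^T) 0 0.

Let edot_bilinear : bilinear_for
  (GRing.Scale.Law.clone _ _ *%R _) (GRing.Scale.Law.clone _ _ (idfun \; *%R) _)
  edot.
Proof.
split=> [v|u] a x y /=.
- by rewrite /edot mulmxDl -scalemxAl !mxE.
- by rewrite /edot linearP/= mulmxDr -scalemxAr !mxE.
Qed.

HB.instance Definition _ := bilinear_isBilinear.Build R V V R _ _ edot
  edot_bilinear.

Let edotC (u v : V) : edot u v = (-1) ^+ false * idfun (edot v u).
Proof.
rewrite /= mul1r /edot !mxE.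
by apply: eq_bigr => i _; rewrite !mxE mulrC.
Qed.

HB.instance Definition _ := isHermitianSesquilinear.Build R V false idfun edot
  edotC.

Let edot_gt0 (u : V) : u != 0 -> 0 < edot u u.
Proof.
move=> u0; have sq i : true -> 0 <= u 0 i * u^T i 0.
  by move=> _; rewrite !mxE -expr2 sqr_ge0.
rewrite /edot mxE lt_def sumr_ge0 ?andbT//.
apply: contra u0; rewrite psumr_eq0// => /allP h; apply/eqP/rowP => i.
by have := h i (mem_index_enum _); rewrite !mxE mulf_eq0 orbb => /eqP.
Qed.

HB.instance Definition _ := isDotProduct.Build R V edot edot_gt0.

Definition orthocompl (L : {vspace V}) : {vspace V} := orthov edot L.

(* Projection onto E along its orthogonal complement. *)
Definition orthoproj (E : {vspace V}) : 'End(V) := daddv_pi E (orthocompl E).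

(* The default value vbasis is irrelevant: every subspace has an orthonormal
   basis. The choice made here is immaterial as well, since the Lebesgue
   measure is invariant under isometries. *)
Definition onb (L : {vspace V}) : (\dim L).-tuple V :=
  xget (vbasis L) [set e : (\dim L).-tuple V | basis_of L e /\ orthonormal edot e].

Definition flat (x : V) (L : {vspace V}) : set V := [set x + h | h in [set` L]].

(* Cartesian coordinates on the affine subspace x + L. *)
Definition flat_coord (x : V) (L : {vspace V})
    (t : (\dim L).-tuple (measurableTypeR R)) : V :=
  x + \sum_(i < \dim L) (tnth t i : R) *: tnth (onb L) i.

(* The (\dim L)-dimensional volume of a subset A of x + L. *)
Definition flat_vol (x : V) (L : {vspace V}) (A : set V) : \bar R :=
  lebesgue_vol (@flat_coord x L @^-1` A).

Definition subspace_vol (L : {vspace V}) (A : set V) : \bar R := flat_vol 0 L A.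

Definition measurable_in (L : {vspace V}) (A : set V) : Prop :=
  A `<=` [set` L] /\ lebesgue_measurable (@flat_coord 0 L @^-1` A).

Definition convex_body (K : set V) : Prop :=
  [/\ compact K, convex_set K & K° !=set0].

Definition cylinder (B : set V) (H : {vspace V}) : set V :=
  [set b + h | b in B & h in [set` H]].

Definition is_cylinder (k : nat) (B : set V) (H : {vspace V}) : Prop :=
  \dim H = k /\ measurable_in (orthocompl H) B.

(* The cylinder is B + H; B is recovered from it as its intersection with
   orthocompl H. *)
Definition crv (K B : set V) (H : {vspace V}) : \bar R :=
  (subspace_vol (orthocompl H) B /
   subspace_vol (orthocompl H) (orthoproj (orthocompl H) @` K))%E.

Definition fold_packing (r : nat) (K : set V) (N : nat)
    (B : 'I_N -> set V) (H : 'I_N -> {vspace V}) : Prop :=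
  (forall i, B i `<=` orthoproj (orthocompl (H i)) @` K) /\
  (forall x, K x ->
    (#|[pred i | `[< (cylinder (B i) (H i) `&` K)° x >]]| <= r)%N).

Definition section_vols (A : set V) (H : {vspace V}) : set (\bar R) :=
  [set flat_vol x H (A `&` flat x H) | x in [set: V]].

End euclidean.

Definition is_max {R : realType} (S : set (\bar R)) (m : \bar R) : Prop :=
  S m /\ ubound S m.

(* Main.v *)
Require Import Defs.
From HB Require Import structures.
From mathcomp Require Import all_boot all_order all_algebra.
From mathcomp Require Import all_classical all_reals all_analysis.
From mathcomp Require Import measurable_realfun ring lra.

Set Implicit Arguments.
Unset Strict Implicit.
Unset Printing Implicit Defensive.

Import Order.TTheory GRing.Theory Num.Theory.
Import numFieldNormedType.Exports.

Local Open Scope classical_set_scope.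
Local Open Scope ring_scope.

(** Fix a cylinder C = B + H, put E = H^perp, k = dim H, m = dim E = d - k, and
    let c be the body obtained by cutting C with K.  Write nu for the product of
    the volumes of E and of H, carried over to R^d along (e, h) |-> e + h.  Two
    classical inequalities compare nu of a body A with its shadow P_E A and its
    largest section M(A) parallel to H:
      nu(A) <= vol_m(P_E A) * M(A)                         (Fubini), and
      vol_m(P_E A) * M(A) <= binom(d, k) * nu(A)           (Rogers-Shephard).
    The packing condition forces P_E c = B.  The first inequality for K and the
    second one for c then give
      crv_K(C) <= binom(d, k) * (nu(c) / nu(K)) * (M(K) / M(c)).
    The ratio nu(c) / nu(K) does not depend on the splitting of R^d: nu is
    invariant under translations, hence proportional to the Lebesgue measure of
    R^d ([product_vol_proportional]), so the ratio is vol_d(c) / vol_d(K).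
    Summing over the cylinders it remains to bound the sum of vol_d(c) by
    r * vol_d(K); integrating the number of interiors that contain a point does
    this, because the boundary of a convex body is a null set
    ([body_vol_interior], [fold_packing_vol]).

    The Rogers-Shephard inequality ([rogers_shephard]) rests on convexity.  Let
    e0 be the E-coordinate of a section of volume M.  If e is in the shadow, then
    c contains the convex hull of that section and a point above e; hence the
    section over (1 - u) e + u e0 has volume at least u^k M, by homogeneity.
    Integrating, nu(c) is at least M * vol_m(P_E c) times the Beta integral
    k * int_0^1 u^(k-1) (1-u)^m du = 1 / binom(d, k).  The integral is replaced
    by lower sums over u = (i + 1) / (n + 1), whose weights are chosen so that
    the convolution of binomial coefficients [sum_bin_conv] evaluates them in
    closed form; then n goes to infinity.

    Proportionality is the uniqueness of the Haar measure for R^d: for a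
    translation invariant nu, integrating over the set of pairs (x, y) with x in
    A and x + y in B in both orders gives
      vol(A) * nu(B) = vol(B) * nu(-A),
    and comparing with the case nu = vol removes the sign.

    The maxima exist because the volume of the section of a compact set is upper
    semicontinuous in the position of the section ([section_vol_usc]).  Shadows
    and sections of compact sets are compact, hence their coordinate preimages are
    Borel, and there the outer measure coincides with the measure. *)

(** * Lebesgue measure of R^n under homotheties and translations *)

Local Notation pushforward_measure :=
  measure_function_pushforward__canonical__measure_function_Measure.

Section scaling.
Context d1 d2 (T1 : measurableType d1) (T2 : measurableType d2) (R : realType).

(** The rescaled pushforward of the product measure along (f1, f2) agrees with it
    on rectangles, and rectangles determine a product measure.  This is the inductive step for
    [lebesgue_tuple_affine], and it also gives the invariance of the product of
    the volumes of two complementary subspaces. *)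
Lemma product_measure_scaling (m1 : {sigma_finite_measure set T1 -> \bar R})
    (m2 : {sigma_finite_measure set T2 -> \bar R})
    (f1 : T1 -> T1) (f2 : T2 -> T2) (c1 c2 : R) :
    measurable_fun setT f1 -> measurable_fun setT f2 -> 0 < c1 -> 0 < c2 ->
    (forall A, measurable A -> c1%:E * m1 (f1 @^-1` A) = m1 A)%E ->
    (forall A, measurable A -> c2%:E * m2 (f2 @^-1` A) = m2 A)%E ->
  forall A, measurable A ->
  ((c1 * c2)%:E * (m1 \x m2) ((fun z => (f1 z.1, f2 z.2)) @^-1` A) =
   (m1 \x m2) A)%E.
Proof.
move=> mf1 mf2 c1_gt0 c2_gt0 h1 h2 A mA.
pose f z := (f1 z.1, f2 z.2).
have mf : measurable_fun setT f.
  by apply: measurable_fun_pair; apply: measurableT_comp.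
pose c : {nonneg R} := NngNum (ltW (mulr_gt0 c1_gt0 c2_gt0)).
pose m' := mscale c (pushforward_measure (m1 \x m2)%E mf).
symmetry; apply: (@product_measure_unique _ _ _ _ R m1 m2 m') => // X Y mX mY.
change ((c1 * c2)%:E * (m1 \x m2) ((f1 @^-1` X) `*` (f2 @^-1` Y)) =
  m1 X * m2 Y)%E.
rewrite product_measure1E//.
- by rewrite EFinM muleACA h1// h2.
- by rewrite -[X in measurable X]setTI; exact: mf1.
- by rewrite -[X in measurable X]setTI; exact: mf2.
Qed.
End scaling.

Section lebesgue_affine.
Context {R : realType}.
Local Notation mR := (measurableTypeR R).

Lemma lebesgue_measure_affine (c v : R) (A : set mR) : 0 < c -> measurable A ->
  (c%:E * lebesgue_measure [set x : mR | A (c * x + v)%R] = lebesgue_measure A)%E.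
Proof.
move=> c0 mA.
pose f (x : mR) : mR := c * x + v.
have mf : measurable_fun setT f.
  by apply: measurable_funD => //; apply: measurable_funM.
pose cn : {nonneg R} := NngNum (ltW c0).
pose m' := mscale cn (pushforward_measure (@lebesgue_measure R) mf).
symmetry; apply: (@lebesgue_measure_unique R m') => // _ [[a b] _ <-] /=.
rewrite /m' /mscale/= /pushforward.
have -> : f @^-1` `]a, b] = [set` `](a - v) / c, (b - v) / c]].
  apply/seteqP; split => x; rewrite /f/= !in_itv/= ltr_pdivrMr// ler_pdivlMr//;
   rewrite ltrBlDr lerBrDr mulrC//.
rewrite !lebesgue_measure_itv/= !lte_fin ltr_pM2r ?invr_gt0// ltrD2r.
case: ifP => _; last by rewrite mule0.
rewrite -!EFinB -EFinM; congr EFin; field; exact: lt0r_neq0.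
Qed.

Definition tuple_affine n (c : R) (v t : n.-tuple mR) : n.-tuple mR :=
  [tuple c * tnth t i + tnth v i | i < n].

Lemma measurable_tuple_affine n c (v : n.-tuple mR) : measurable_fun setT (tuple_affine c v).
Proof.
apply/measurable_fun_tnthP => i.
rewrite (_ : _ \o _ = fun t => (c * tnth t i + tnth v i : mR)).
  apply: measurable_funD => //; apply: measurable_funM => //.
  exact: measurable_tnth.
by apply/funext => t /=; rewrite tnth_mktuple.
Qed.

Lemma lebesgue_tuple_affine n (c : R) (v : n.-tuple mR) (A : set (n.-tuple mR)) :
  0 < c -> measurable A ->
  ((c ^+ n)%:E * lebesgue_tuple n (tuple_affine c v @^-1` A) = lebesgue_tuple n A)%E.
Proof.
move=> c0; elim: n v A => [|n ih] v A mA.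
  rewrite expr0 mul1e; congr (lebesgue_tuple 0 _); apply/seteqP.
  by split => t /=; rewrite (tuple0 t) (tuple0 (tuple_affine _ _ _)).
rewrite exprS /= /cons_measure /pushforward.
have [v0 [w ->]] : exists v0 w, v = cons_pair (v0, w).
  exists (thead v), [tuple of behead v]; rewrite [LHS]tuple_eta.
  by apply/val_inj.
rewrite (_ : _ @^-1` _ = (fun z => (c * z.1 + v0, tuple_affine c w z.2)) @^-1`
    (@cons_pair R n @^-1` A)); last first.
  apply/funext => -[x t] /=; congr (A _); apply/eq_from_tnth => i.
  rewrite tnth_mktuple.
  by case: (unliftP ord0 i) => [j ->|->]; rewrite ?tnthS ?tnth0//= tnth_mktuple.
apply: (@product_measure_scaling _ _ _ _ R lebesgue_measure (lebesgue_tuple n)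
  (fun x => c * x + v0) (tuple_affine c w) c (c ^+ n)) => //.
- by apply: measurable_funD => //; apply: measurable_funM.
- exact: measurable_tuple_affine.
- exact: exprn_gt0.
- by move=> B mB; exact: lebesgue_measure_affine.
- by move=> B mB; exact: ih.
- by rewrite -[X in measurable X]setTI; exact: measurable_cons_pair.
Qed.

Definition cube n (a : R) : set (n.-tuple mR) := [set t | forall i, `|tnth t i| <= a].
Arguments cube n a : clear implicits.

Lemma measurable_cube n a : measurable (cube n a).
Proof.
rewrite (_ : cube n a = \bigcap_(i in [set: 'I_n])
   ((fun t : n.-tuple mR => tnth t i) @^-1` `[-a, a])).
  apply: fin_bigcap_measurable => // i _; rewrite -[X in measurable X]setTI.
  exact: measurable_tnth.
apply/seteqP; split => t /=.
  by move=> h i _; rewrite /= in_itv/= -ler_norml; exact: h.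
by move=> h i; have := h i I; rewrite /= in_itv/= -ler_norml.
Qed.

Lemma lebesgue_tuple_cube n (a : R) : 0 <= a ->
  lebesgue_tuple n (cube n a) = ((2 * a) ^+ n)%:E.
Proof.
move=> a0; elim: n => [|n ih].
  by rewrite /= diracE mem_set// => -[].
rewrite /= /cons_measure /pushforward.
rewrite (_ : _ @^-1` _ = (`[-a, a]%classic : set mR) `*` cube n a).
  rewrite product_measure1E//; last exact: measurable_cube.
  rewrite ih [X in (X * _)%E](lebesgue_measure_itv `[- a, a])/= lte_fin; case: ltP => h.
    by rewrite exprS EFinM; congr (_ * _)%E; rewrite -EFinB; congr EFin; lra.
  have -> : a = 0 by lra.
  by rewrite mul0e exprS mulr0 mul0r.
apply/seteqP; split => -[x t] /=.
  move=> h; split; first by have := h ord0; rewrite /= in_itv/= -ler_norml tnth0.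
  by move=> i; have := h (lift ord0 i); rewrite tnthS.
move=> [+ h]; rewrite in_itv/= -ler_norml => xa i.
by case: (unliftP ord0 i) => [j ->|->]; rewrite ?tnthS ?tnth0.
Qed.

End lebesgue_affine.

Arguments cube {R} n a.

(** * Borel sets through coordinates *)

Section coordinatewise_measurable.
Context {R : realType} {d'} {Z : measurableType d'} {n : nat}.
Variable f : Z -> 'rV[R]_n.
Hypothesis mf : forall i, measurable_fun setT (fun z => f z 0 i : measurableTypeR R).

(** Tuples carry the product sigma-algebra and rows the product topology; the
    bridge is that an open set is the countable union of the balls with rational
    centre and radius 1 / (k + 1) that it contains. *)
Lemma measurable_preimage_open (U : set 'rV[R]_n) : open U -> measurable (f @^-1` U).
Proof.
move=> oU.
pose ctr (q : 'rV[rat]_n) : 'rV[R]_n := map_mx ratr q.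
pose F (p : 'rV[rat]_n * nat) : set Z :=
  if `[< ball (ctr p.1) (p.2.+1%:R^-1) `<=` U >]
  then f @^-1` (ball (ctr p.1) (p.2.+1%:R^-1)) else set0.
have -> : f @^-1` U = \bigcup_p F p.
  apply/seteqP; split => [z /= Ufz|z [p _]]; last first.
    by rewrite /F; case: asboolP => // + ?; apply.
  have /nbhs_ballP[e /= e0 eU] : nbhs (f z) U by exact: open_nbhs_nbhs.
  have [k ke] : exists k : nat, k.+1%:R^-1 < e / 2.
    exists (Num.truncn (e / 2)^-1).
    rewrite invf_plt ?posrE ?divr_gt0//; exact: truncnS_gt.
  have k0 : 0 < k.+1%:R^-1 :> R by rewrite invr_gt0.
  have /choice[q qE] : forall i, exists q : rat, `|ratr q - f z 0 i| < k.+1%:R^-1.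
    move=> i; have [|q] := @rat_in_itvoo R (f z 0 i - k.+1%:R^-1) (f z 0 i + k.+1%:R^-1).
      by rewrite ltrD2l gtrN.
    by rewrite in_itv/= => qi; exists q; rewrite ltr_distl.
  exists (\row_i q i, k) => //; rewrite /F; case: asboolP => /=.
    by move=> _; split => // a i; rewrite (ord1 a) !mxE; exact: qE.
  case; move=> y [_ yq]; apply: eU; split => // a i; rewrite (ord1 a).
  have := yq 0 i; have := qE i; rewrite !mxE /ball/= => h1 h2.
  rewrite [f z 0 i - _](_ : _ = - (ratr (q i) - f z 0 i) +
    (ratr (q i) - y 0 i)); last by ring.
  rewrite (le_lt_trans (ler_normD _ _))// normrN.
  by rewrite (splitr e) ltrD// (lt_trans _ ke).
apply: countable_bigcupT_measurable => // -[q k]; rewrite /F/=.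
case: asboolP => // _.
rewrite (_ : _ @^-1` _ = \bigcap_(i in [set: 'I_n])
  ((fun z => f z 0 i : measurableTypeR R) @^-1` (ball (ctr q 0 i) (k.+1%:R^-1)))).
  apply: fin_bigcap_measurable => // i _; rewrite -[X in measurable X]setTI.
  by apply: (mf i measurableT); exact: measurable_ball.
apply/seteqP; split => z /= h; first by move=> i _; apply h.
by split; [rewrite invr_gt0|move=> a i; rewrite (ord1 a); exact: h].
Qed.

Lemma measurable_preimage_closed (C : set 'rV[R]_n) : closed C -> measurable (f @^-1` C).
Proof.
move=> cC; rewrite -[X in measurable X]setCK; apply: measurableC.
rewrite preimage_setC; exact: (measurable_preimage_open (closed_openC cC)).
Qed.

End coordinatewise_measurable.

(** * Uniqueness of translation invariant measures *)

Section haar.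
Context {R : realType}.
Local Notation mR := (measurableTypeR R).

Lemma product_measure_xsection_const d1 d2 (T1 : measurableType d1)
    (T2 : measurableType d2) (m1 : {measure set T1 -> \bar R})
    (m2 : {sigma_finite_measure set T2 -> \bar R}) (A : set T1)
    (W : set (T1 * T2)) (c : \bar R) :
  measurable A -> (0 <= c)%E ->
  (forall x, A x -> m2 (xsection W x) = c) ->
  (forall x, ~ A x -> xsection W x = set0) ->
  ((m1 \x m2) W = m1 A * c)%E.
Proof.
move=> mA c0 WA WnA; rewrite /product_measure1.
rewrite (eq_integral (fun x => (\1_A x)%:E * c))%E; last first.
  move=> x _ /=; rewrite indicE; have [xA|xA] := boolP (x \in A).
    by rewrite mul1e WA//; rewrite inE in xA.
  by rewrite mul0e WnA ?measure0//; rewrite notin_setE in xA.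
by rewrite ge0_integralZr ?integral_indic ?setIT//; exact: measurableT_comp.
Qed.

Definition row_of_tuple n (t : n.-tuple mR) : 'rV[R]_n := \row_i tnth t i.

Lemma measurable_row_of_tuple n i :
  measurable_fun setT (fun t : n.-tuple mR => row_of_tuple t 0 i : mR).
Proof.
rewrite (_ : (fun t => _) = (@tnth n mR ^~ i)); first exact: measurable_tnth.
by apply/funext => t; rewrite mxE.
Qed.

Lemma row_of_tuple_affine n c (v : 'rV[R]_n) (t : n.-tuple mR) :
  row_of_tuple (tuple_affine c [tuple v 0 i | i < n] t) = c *: row_of_tuple t + v.
Proof. by apply/rowP => i; rewrite !mxE !tnth_mktuple. Qed.

Lemma lebesgue_tuple_shift n (A : set 'rV[R]_n) (v : 'rV[R]_n) : closed A ->
  lebesgue_tuple n [set t | A (row_of_tuple t + v)] =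
  lebesgue_tuple n [set t | A (row_of_tuple t)].
Proof.
move=> cA.
have mA := measurable_preimage_closed (@measurable_row_of_tuple n) cA.
rewrite -[RHS](@lebesgue_tuple_affine R n 1 [tuple v 0 i | i < n])//.
rewrite expr1n mul1e; congr (lebesgue_tuple n _); apply/seteqP.
by split => t /=; rewrite row_of_tuple_affine scale1r.
Qed.

Lemma closed_negate n (A : set 'rV[R]_n) : closed A -> closed [set y | A (- y)].
Proof. by move=> cA; apply: preimage_closed => // x _; exact: opp_continuous. Qed.

Lemma closed_shift n (A : set 'rV[R]_n) (v : 'rV[R]_n) :
  closed A -> closed [set y | A (y + v)].
Proof.
have shift_cont : continuous (fun y : 'rV[R]_n => y + v).
  by move=> x; apply: continuousD; [exact: cvg_id|exact: cst_continuous].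
by move=> cA; apply: (@preimage_closed _ _ (fun y : 'rV[R]_n => y + v)) => // x _.
Qed.

(** For x in A, the x-section of the set W of pairs (x, z) with x in A and
    x + phi z in B has measure lam (phi^-1 B), by the invariance of lam.
    Translating x by phi z turns its z-sections into those of the set W' of pairs
    with x - phi z in A and x in B, whose x-sections for x in B have measure
    lam (phi^-1 (- A)). *)
Lemma shift_invariant_exchange d (Z : measurableType d) n
    (lam : {sigma_finite_measure set Z -> \bar R}) (phi : Z -> 'rV[R]_n)
    (A B : set 'rV[R]_n) :
  (forall i, measurable_fun setT (fun z => phi z 0 i : mR)) ->
  (forall (D : set 'rV[R]_n) v, closed D ->
     lam [set z | D (phi z + v)] = lam [set z | D (phi z)]) ->
  closed A -> closed B ->
  (lebesgue_tuple n [set x | A (row_of_tuple x)] * lam [set z | B (phi z)] =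
   lebesgue_tuple n [set x | B (row_of_tuple x)] * lam [set z | A (- phi z)%R])%E.
Proof.
move=> mphi invphi cA cB; set mu := lebesgue_tuple n.
have mfst (i : 'I_n) :
    measurable_fun setT (fun p : n.-tuple mR * Z => row_of_tuple p.1 0 i : mR).
  exact: (measurableT_comp (@measurable_row_of_tuple n i) measurable_fst).
have msnd (i : 'I_n) :
    measurable_fun setT (fun p : n.-tuple mR * Z => phi p.2 0 i : mR).
  exact: (measurableT_comp (mphi i) measurable_snd).
pose W :=
  [set p : n.-tuple mR * Z | A (row_of_tuple p.1) /\ B (phi p.2 + row_of_tuple p.1)].
pose W' :=
  [set p : n.-tuple mR * Z | A (row_of_tuple p.1 - phi p.2) /\ B (row_of_tuple p.1)].
have mW : measurable W.
  apply: measurableI; first exact: (measurable_preimage_closed mfst cA).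
  apply: (measurable_preimage_closed
    (f := fun p : n.-tuple mR * Z => phi p.2 + row_of_tuple p.1) _ cB) => i.
  rewrite (_ : (fun z => _) =
      (fun p => phi p.2 0 i : mR) \+ (fun p => row_of_tuple p.1 0 i)).
    exact: (measurable_funD (msnd i) (mfst i)).
  by apply/funext => p; rewrite /= !mxE.
have mW' : measurable W'.
  apply: measurableI; last exact: (measurable_preimage_closed mfst cB).
  apply: (measurable_preimage_closed
    (f := fun p : n.-tuple mR * Z => row_of_tuple p.1 - phi p.2) _ cA) => i.
  rewrite (_ : (fun z => _) =
      (fun p => row_of_tuple p.1 0 i : mR) \- (fun p => phi p.2 0 i)).
    exact: (measurable_funB (mfst i) (msnd i)).
  by apply/funext => p; rewrite /= !mxE.
transitivity ((mu \x lam)%E W).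
  symmetry; apply: product_measure_xsection_const.
  - exact: (measurable_preimage_closed (@measurable_row_of_tuple n) cA).
  - exact: measure_ge0.
  - move=> x Ax; rewrite -(invphi B (row_of_tuple x))//; congr (lam _).
    by apply/seteqP; split => z /=; [move/xsectionP => -[]|move=> ?; apply/xsectionP].
  - by move=> x nAx; apply/seteqP; split => z //= /xsectionP[].
transitivity ((mu \x lam)%E W').
  have swap X : measurable X -> (mu \x lam)%E X = (mu \x^ lam)%E X.
    move=> mX; apply: product_measure_unique => // P Q mP mQ.
    exact: product_measure2E.
  rewrite !swap//; apply: eq_integral => z _ /=.
  have cD : closed [set y | A (y - phi z) /\ B y].
    by apply: closedI => //; exact: closed_shift.
  transitivity (mu [set x | (fun y => A (y - phi z) /\ B y) (row_of_tuple x + phi z)]).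
    congr (mu _); apply/seteqP; split => x.
      by move/ysectionP => [/= Ax Bx]; rewrite addrK addrC.
    by rewrite /= addrK addrC => ?; apply/ysectionP.
  rewrite (lebesgue_tuple_shift _ cD); congr (mu _).
  by apply/seteqP; split => x; [move=> ?; apply/ysectionP|move/ysectionP].
apply: product_measure_xsection_const.
- exact: (measurable_preimage_closed (@measurable_row_of_tuple n) cB).
- exact: measure_ge0.
- move=> x Bx.
  rewrite -(invphi [set y | A (- y)] (- row_of_tuple x) (closed_negate cA)).
  congr (lam _); apply/seteqP; split => z /=.
    by move/xsectionP => -[/=]; rewrite opprD opprK addrC.
  by rewrite opprD opprK addrC => ?; apply/xsectionP.
- by move=> x nBx; apply/seteqP; split => z //= /xsectionP[].
Qed.

(** Exchanging A and B against the Lebesgue measure itself shows that it is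
    symmetric under negation, which removes the sign in
    [shift_invariant_exchange]. *)
Lemma shift_invariant_proportional d (Z : measurableType d) n
    (lam : {sigma_finite_measure set Z -> \bar R}) (phi : Z -> 'rV[R]_n)
    (A B : set 'rV[R]_n) :
  (forall i, measurable_fun setT (fun z => phi z 0 i : mR)) ->
  (forall (D : set 'rV[R]_n) v, closed D ->
     lam [set z | D (phi z + v)] = lam [set z | D (phi z)]) ->
  closed A -> closed B ->
  lebesgue_tuple n [set x | B (row_of_tuple x)] \is a fin_num ->
  (0 < lebesgue_tuple n [set x | B (row_of_tuple x)])%E ->
  (lebesgue_tuple n [set x | A (row_of_tuple x)] * lam [set z | B (phi z)] =
   lebesgue_tuple n [set x | B (row_of_tuple x)] * lam [set z | A (phi z)])%E.
Proof.
move=> mphi invphi cA cB Bfin B0.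
have Asym : lebesgue_tuple n [set x | A (row_of_tuple x)] =
            lebesgue_tuple n [set x | A (- row_of_tuple x)%R].
  have := shift_invariant_exchange (@measurable_row_of_tuple n)
    (fun D v => @lebesgue_tuple_shift n D v) cA cB.
  rewrite muleC => /eqP; rewrite eq_le !lee_pmul2l// -eq_le => /eqP.
  exact.
rewrite Asym.
have := shift_invariant_exchange mphi invphi (closed_negate cA) cB => ->.
by congr (_ * lam _)%E; apply/seteqP; split => z; rewrite /= opprK.
Qed.
End haar.

(** * Linear coordinates on a subspace *)

Section linear_coordinates.
Context {R : realType} {d : nat}.
Local Notation mR := (measurableTypeR R).
Local Notation V := 'rV[R]_d.
Implicit Types (L E H : {vspace V}) (x v : V).

Lemma onb_basis L : basis_of L (onb L).
Proof.
rewrite /onb; case: xgetP => [e _ []//|_]; exact: vbasisP.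
Qed.

Lemma orthocompl_capv L : (L :&: orthocompl L)%VS = 0%VS.
Proof.
apply/eqP; rewrite -subv0; apply/subvP => v /memv_capP[vL /mem_orthovP/(_ v vL) vv].
rewrite memv0; apply/eqP/rowP => i.
have : edot v v == 0 by rewrite vv.
rewrite /edot mxE psumr_eq0 => [/allP/(_ i (mem_index_enum _))|j _].
  by rewrite !mxE mulf_eq0 orbb => /eqP.
by rewrite !mxE -expr2 sqr_ge0.
Qed.

(** Pairing with a basis of L is a linear map onto at most dim L coordinates, and
    its kernel is orthogonal to L; the rank formula gives the dimension. *)
Lemma orthocompl_addv L : (L + orthocompl L)%VS = fullv.
Proof.
pose M : 'M[R]_(d, \dim L) := \matrix_(i, j) (vbasis L)`_j 0 i.
pose f : 'Hom(V, 'rV[R]_(\dim L)) := linfun (mulmxr M).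
have kerf : (lker f <= orthocompl L)%VS.
  apply/subvP => u; rewrite memv_ker lfunE/= => /eqP uM.
  apply/mem_orthovP => v /coord_vbasis ->.
  rewrite linear_sumr big1// => i _; rewrite linearZr/=.
  have /rowP/(_ i) := uM; rewrite !mxE => {}uM.
  rewrite /edot mxE (eq_bigr (fun j => u 0 j * M j i)) ?uM ?mulr0// => j _.
  by rewrite !mxE.
apply/eqP; rewrite eqEdim subvf/= dimv_disjoint_sum ?orthocompl_capv//.
rewrite (leq_trans _ (leq_add (leqnn _) (dimvS kerf)))//.
have := limg_ker_dim f fullv; rewrite capfv => <-.
rewrite addnC leq_add2r (leq_trans (dimvS (subvf _)))// dimvf.
by rewrite /dim/= mul1n.
Qed.

Lemma orthocomplK L : orthocompl (orthocompl L) = L.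
Proof.
apply/esym/eqP; rewrite eqEdim; apply/andP; split.
  rewrite orthov_sym; exact: subvv.
rewrite -(leq_add2l (\dim (orthocompl L))) -dimv_disjoint_sum ?orthocompl_capv//.
rewrite orthocompl_addv -(orthocompl_addv L) addnC -dimv_disjoint_sum//.
exact: orthocompl_capv.
Qed.

Lemma orthoproj_split H (b h : V) : b \in orthocompl H -> h \in H ->
  orthoproj (orthocompl H) (b + h) = b.
Proof.
move=> bE hH; rewrite /orthoproj orthocomplK linearD/=.
have EH0 : (orthocompl H :&: H)%VS = 0%VS by rewrite capvC orthocompl_capv.
rewrite (daddv_pi_id EH0 bE).
have := @daddv_pi_add _ _ _ _ h EH0 (subvP (addvSr _ _) _ hH).
rewrite (@daddv_pi_id _ _ H (orthocompl H))//; last by rewrite capvC.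
move=> /eqP; rewrite -[X in _ == X]add0r (inj_eq (addIr h)) => /eqP ->.
by rewrite addr0.
Qed.

Lemma mx_coord_le_norm n (v : 'rV[R]_n) j : `|v 0 j| <= `|v|.
Proof.
rewrite [leRHS]/Num.norm/= mx_normrE.
exact: (le_bigmax _ (fun ij : 'I_1 * 'I_n => `|v ij.1 ij.2|) (0, j)).
Qed.

Lemma linear_rV_bounded (W : normedModType R) (f : {linear V -> W}) :
  exists2 C, 0 <= C & forall v, `|f v| <= C * `|v|.
Proof.
exists (\sum_j `|f 'e_j|) => [|v]; first by apply: sumr_ge0.
rewrite {1}(row_sum_delta v) linear_sum (le_trans (ler_norm_sum _ _ _))//.
rewrite mulr_suml; apply: ler_sum => j _.
by rewrite linearZ/= normrZ mulrC ler_wpM2l// mx_coord_le_norm.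
Qed.

Lemma linear_rV_continuous (W : normedModType R) (f : {linear V -> W}) :
  continuous f.
Proof.
apply: bounded_linear_continuous; apply/linear_boundedP.
have [C C0 fC] := linear_rV_bounded f.
near=> r => v; rewrite (le_trans (fC v))// ler_wpM2r//.
Unshelve. all: end_near. Qed.

Definition lincomb L (t : (\dim L).-tuple mR) : V :=
  \sum_(i < \dim L) (tnth t i : R) *: tnth (onb L) i.

Lemma mem_lincomb L t : @lincomb L t \in L.
Proof.
apply: memv_suml => i _; apply: memvZ.
by rewrite (basis_mem (onb_basis L))// mem_tnth.
Qed.

Lemma lincomb_surj L v : v \in L -> exists t, @lincomb L t = v.
Proof.
move=> vL; exists [tuple coord (onb L) i v | i < \dim L].
rewrite [RHS](coord_basis (onb_basis L) vL); apply: eq_bigr => i _.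
by rewrite tnth_mktuple -tnth_nth.
Qed.

Lemma lincomb_affine L c (v t : (\dim L).-tuple mR) :
  lincomb (tuple_affine c v t) = c *: lincomb t + lincomb v.
Proof.
rewrite /lincomb scaler_sumr -big_split/=; apply: eq_bigr => i _.
by rewrite tnth_mktuple scalerDl scalerA.
Qed.

Lemma measurable_lincomb L i :
  measurable_fun setT (fun t => @lincomb L t 0 i : mR).
Proof.
rewrite (_ : (fun t => _) =
    fun t => \sum_(j < \dim L) (tnth t j : mR) * tnth (onb L) j 0 i).
  apply: measurable_sum => j; apply: measurable_funM => //.
  exact: measurable_tnth.
by apply/funext => t; rewrite /lincomb summxE; apply: eq_bigr => j _; rewrite mxE.
Qed.

(** Coordinates are linear functionals, hence bounded; so bounded sets have bounded
    coordinate preimages, which is where finiteness of volumes comes from. *)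
Lemma lincomb_bounded_below L :
  exists2 C, 0 <= C & forall (t : (\dim L).-tuple mR) i, `|tnth t i| <= C * `|lincomb t|.
Proof.
have /choice[C] : forall i : 'I_(\dim L), exists C, 0 <= C /\
    forall t : (\dim L).-tuple mR, `|tnth t i| <= C * `|lincomb t|.
  move=> i; pose f : {linear V -> R^o} := coord (onb L) i.
  have [C C0 fC] := linear_rV_bounded f; exists C; split => // t.
  suff <- : f (lincomb t) = tnth t i by [].
  rewrite /f/= /lincomb.
  under eq_bigr do rewrite [X in _ *: X](tnth_nth 0).
  by rewrite (coord_sum_free (fun j => tnth t j : R))// (basis_free (onb_basis L)).
move=> hC; exists (\sum_i C i) => [|t i]; first by apply: sumr_ge0 => i _; have [] := hC i.
have [Ci0 /(_ t) /le_trans] := hC i; apply; rewrite ler_wpM2r// (bigD1 i)//=.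
by rewrite lerDl sumr_ge0// => j _; have [] := hC j.
Qed.

Lemma lincomb_preimage_cube L (A : set V) x : bounded_set A ->
  exists2 a, 0 <= a & forall t, A (x + @lincomb L t) -> cube (\dim L) a t.
Proof.
move=> [M [_ hM]]; have [C C0 hC] := lincomb_bounded_below L.
exists (C * (`|M| + 1 + `|x|)) => [|t At i]; first by rewrite mulr_ge0// !addr_ge0.
rewrite (le_trans (hC t i))// ler_wpM2l// -(addKr x (lincomb t)) addrC.
rewrite (le_trans (ler_normB _ _))// lerD2r hM//.
by rewrite (le_lt_trans (ler_norm _))// ltrDl.
Qed.

End linear_coordinates.

(** * Sections of maximal volume *)

Section section_volume.
Context {R : realType} {d : nat}.
Local Notation mR := (measurableTypeR R).
Local Notation V := 'rV[R]_d.
Implicit Types (L E H : {vspace V}) (A : set V) (x : V).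

Definition section_vol H A x : \bar R :=
  lebesgue_tuple (\dim H) [set t | A (x + lincomb (L := H) t)].

Lemma measurable_add_lincomb L x i :
  measurable_fun setT (fun t => (x + lincomb (L := L) t) 0 i : mR).
Proof.
rewrite (_ : (fun t => _) = (cst (x 0 i : mR)) \+ (fun t => lincomb (L := L) t 0 i)).
  by apply: measurable_funD => //; exact: measurable_lincomb.
by apply/funext => t; rewrite !mxE.
Qed.

Lemma section_vol_fin_num H A x : closed A -> bounded_set A ->
  section_vol H A x \is a fin_num.
Proof.
move=> cA /(@lincomb_preimage_cube _ _ H _ x)[a a0 Aa].
rewrite ge0_fin_numE ?measure_ge0//.
rewrite (@le_lt_trans _ _ (lebesgue_tuple (\dim H) (cube (\dim H) a)))//.
  apply: le_measure => //; rewrite inE; last exact: measurable_cube.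
  exact: (measurable_preimage_closed (measurable_add_lincomb x)).
by rewrite lebesgue_tuple_cube// ltry.
Qed.

Lemma section_vol_shift H A x h : closed A -> h \in H ->
  section_vol H A (x + h) = section_vol H A x.
Proof.
move=> cA /lincomb_surj[v <-].
rewrite /section_vol -[RHS](@lebesgue_tuple_affine R _ 1 v)//.
  rewrite expr1n mul1e; congr (lebesgue_tuple _ _); apply/funext => t /=.
  by rewrite lincomb_affine scale1r -addrA [_ + lincomb v]addrC.
exact: (measurable_preimage_closed (measurable_add_lincomb x)).
Qed.

Lemma lebesgue_vol_measurable n (X : set (n.-tuple mR)) : measurable X ->
  lebesgue_vol X = lebesgue_tuple n X.
Proof. exact: measurable_mu_extE. Qed.

Lemma flat_vol_section H A x : closed A ->
  flat_vol x H (A `&` flat x H) = section_vol H A x.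
Proof.
move=> cA; rewrite -[RHS]lebesgue_vol_measurable.
  congr lebesgue_vol; apply/funext => t /=; apply/propext; split => [[]//|At].
  by split => //; exists (lincomb t) => //; exact: mem_lincomb.
exact: (measurable_preimage_closed (measurable_add_lincomb x)).
Qed.

Lemma subspace_vol_closed L A : closed A ->
  subspace_vol L A = section_vol L A 0.
Proof.
move=> cA; rewrite -[RHS]lebesgue_vol_measurable//.
exact: (measurable_preimage_closed (measurable_add_lincomb 0)).
Qed.

(** The sections of the open neighbourhoods of A of radius 1 / (n + 1) decrease to
    the section of A, so their volumes converge to the volume of the latter; and
    the n-th one contains every section of A at distance less than 1 / (n + 1). *)
Lemma section_vol_usc H A x c : compact A -> (section_vol H A x < c)%E ->
  \forall y \near x, (section_vol H A y < c)%E.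
Proof.
move=> cptA ltc; have cA := compact_closed (@norm_hausdorff _ _) cptA.
pose U n := \bigcup_(a in A) ball a (n.+1%:R^-1 : R).
pose F n := [set t | U n (x + lincomb (L := H) t)].
have oU n : open (U n) by apply: bigcup_open => a _; exact: ball_open.
have mF n : measurable (F n).
  exact: (measurable_preimage_open (measurable_add_lincomb x)).
have FE : \bigcap_n F n = [set t | A (x + lincomb (L := H) t)].
  apply/seteqP; split => t /= h; last first.
    by move=> n _; exists (x + lincomb t) => //; apply: ballxx; rewrite invr_gt0.
  apply: cA => W /nbhs_ballP[e /= e0 eW].
  have [n ne] : exists n : nat, n.+1%:R^-1 < e.
    exists (Num.truncn e^-1).
    by rewrite invf_plt ?posrE//; exact: truncnS_gt.
  have [a Aa /ball_sym xa] := h n I; exists a; split => //.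
  by apply: eW; exact: le_ball (ltW ne) _ xa.
have bU : bounded_set (U 0%N).
  have [M [_ hM]] := compact_bounded cptA.
  exists (`|M| + 2); split; first by rewrite num_real.
  move=> r rM y [a Aa]; rewrite -ball_normE/= invr1 => ya.
  have aM : `|a| <= `|M| + 1 by apply: hM => //; rewrite (le_lt_trans (ler_norm _))// ltrDl.
  rewrite -(subrK a y) (le_trans (ler_normD _ _))// -normrN opprB; lra.
have F0 : (lebesgue_tuple (\dim H) (F 0%N) < +oo)%E.
  have [a a0 Fa] := @lincomb_preimage_cube _ _ H _ x bU.
  rewrite (@le_lt_trans _ _ (lebesgue_tuple (\dim H) (cube (\dim H) a)))//.
    by apply: le_measure; rewrite ?inE//; exact: measurable_cube.
  by rewrite lebesgue_tuple_cube// ltry.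
have Fcvg : lebesgue_tuple (\dim H) \o F @ \oo --> section_vol H A x.
  rewrite /section_vol -FE; apply: nonincreasing_cvg_mu => //.
    exact: bigcapT_measurable.
  apply/nonincreasing_seqP => n; apply/subsetPset => t [a Aa xa].
  exists a => //; apply: le_ball xa.
  by rewrite lef_pV2 ?posrE// ler_nat.
have [n nc] : exists n, (lebesgue_tuple (\dim H) (F n) < c)%E.
  apply: contrapT => /forallNP h.
  suff : (c <= section_vol H A x)%E by rewrite leNgt ltc.
  rewrite -(cvg_lim _ Fcvg)//; apply: lime_ge; first by apply/cvg_ex; eexists; exact: Fcvg.
  by apply: nearW => n; rewrite leNgt; apply/negP/h.
apply/nbhs_ballP; exists (n.+1%:R^-1) => /=; first by rewrite invr_gt0.
move=> y xy; apply: le_lt_trans nc; apply: le_measure; rewrite ?inE//.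
  exact: (measurable_preimage_closed (measurable_add_lincomb y)).
move=> t /= At; exists (y + lincomb t) => //.
move: xy; rewrite -!ball_normE/= => xy.
by rewrite distrC opprD addrACA subrr addr0.
Qed.

(** A cluster point of the filter generated by the superlevel sets, in A, of the
    volume of the section: were the volume there smaller than at some y in A, upper
    semicontinuity would separate it from the superlevel set of y. *)
Lemma section_vol_max H A : compact A -> A !=set0 ->
  exists2 a, A a & forall x, (section_vol H A x <= section_vol H A a)%E.
Proof.
move=> cptA A0; have cA := compact_closed (@norm_hausdorff _ _) cptA.
suff [a Aa maxa] : exists2 a, A a &
    forall y, A y -> (section_vol H A y <= section_vol H A a)%E.
  exists a => // x.
  have [tx0|/set0P[t At]] := eqVneq [set t | A (x + lincomb (L := H) t)] set0.
    by rewrite /section_vol tx0 measure0 measure_ge0.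
  by rewrite -(section_vol_shift x cA (mem_lincomb t)); exact: maxa.
pose G y := [set x | A x /\ (section_vol H A y <= section_vol H A x)%E].
have FG : ProperFilter (filter_from A G).
  apply: filter_from_proper; last by move=> y Ay; exists y; split.
  apply: filter_from_filter => // y z Ay Az.
  have [yz|/ltW zy] := leP (section_vol H A y) (section_vol H A z).
    by exists z => // x [Ax zx]; split; split => //; exact: le_trans zx.
  by exists y => // x [Ax yx]; split; split => //; exact: le_trans yx.
have GA : filter_from A G A by case: A0 => y Ay; exists y => // x [].
have [a [Aa clGa]] := cptA _ FG GA; exists a => // y Ay; rewrite leNgt; apply/negP.
move=> /(section_vol_usc cptA) near_lt.
have Gy : filter_from A G (G y) by exists y.
by have [x [[_ /le_lt_trans h] /h]] := clGa _ _ Gy near_lt; rewrite ltxx.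
Qed.

End section_volume.

(** * Discrete Beta integrals *)

Section combinatorics.

(** Choosing a + b + 1 elements of {0, ..., n}: sort the choices by the value i of
    their (a + 1)-st smallest element. *)
Lemma sum_bin_conv n a b :
  (\sum_(i < n.+1) 'C(i, a) * 'C(n - i, b) = 'C(n.+1, (a + b).+1))%N.
Proof.
elim: n a b => [|n ih] a b.
  rewrite big_ord_recl big_ord0 addn0 subn0 /= !bin0n binS bin0n.
  by case: a b => [|a] [|b].
case: b => [|b].
  rewrite big_ord_recr/= subnn bin0 muln1 addn0 [RHS]binS.
  congr (_ + _)%N; have := ih a 0%N; rewrite addn0 => <-.
  by apply: eq_bigr => i _; rewrite !bin0.
rewrite big_ord_recr/= subnn bin0n muln0 addn0 addnS binS -ih -addnS -ih.
rewrite addnC -big_split/=; apply: eq_bigr => i _.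
by rewrite -mulnDr subSn ?leq_ord// binS [RHS]mulnC mulnC addnC.
Qed.

Lemma sum_bin n a : (\sum_(i < n) 'C(i, a) = 'C(n, a.+1))%N.
Proof.
case: n => [|n]; first by rewrite big_ord0.
rewrite -[in RHS](addn0 a) -sum_bin_conv.
by apply: eq_bigr => i _; rewrite bin0 muln1.
Qed.

Lemma ffact_leq_exp n m : (n ^_ m <= n ^ m)%N.
Proof.
elim: m => [|m ih]; first by rewrite ffactn0 expn0.
by rewrite ffactnSr expnSr leq_mul// leq_subr.
Qed.

(** That is, n^_m / n^m >= 1 - m^2 / n: the falling factorial is asymptotic to the
    power, in the form that [le_of_le_vanishing] needs. *)
Lemma ffact_ge_exp (R : realFieldType) n m :
  n%:R ^+ m * (n%:R - m%:R ^+ 2) <= n%:R * (n ^_ m)%:R :> R.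
Proof.
elim: m => [|m ih].
  by rewrite expr0 mul1r ffactn0 mulr1 expr0n/= subr0.
have [mn|nm] := leqP m n.
  rewrite ffactnSr natrM natrB// mulrA exprSr.
  have mn' : 0 <= n%:R - m%:R :> R by rewrite subr_ge0 ler_nat.
  apply: le_trans (ler_wpM2r mn' ih); rewrite -!mulrA.
  apply: ler_wpM2l; first exact: exprn_ge0.
  rewrite -natr1; have := ler0n R m; have := ler0n R n; nra.
apply: (@le_trans _ _ 0); last by rewrite mulr_ge0.
apply: mulr_ge0_le0; first exact: exprn_ge0.
have : (n%:R < m%:R :> R) by rewrite ltr_nat.
by rewrite -natr1; have := ler0n R m; have := ler0n R n; nra.
Qed.

Lemma le_of_le_vanishing (R : realType) (b c : R) (y : \bar R) : 0 <= b -> 0 <= c ->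
  (forall n, (b * (1 - c / n.+1%:R))%:E <= y)%E -> (b%:E <= y)%E.
Proof.
move=> b0 c0 h; case: y h => [y|_|/(_ 0%N)//]; last exact: leey.
move=> h; have {}h n : b * (1 - c / n.+1%:R) <= y by rewrite -lee_fin; exact: h.
rewrite lee_fin.
rewrite leNgt; apply/negP => yb.
pose N := Num.truncn (b * c / (b - y)).
have NP : b * c / (b - y) < N.+1%:R by exact: truncnS_gt.
have := h N; rewrite leNgt => /negP; apply.
rewrite ltr_pdivrMr ?subr_gt0// in NP.
have : b * c / N.+1%:R < b - y by rewrite ltr_pdivrMr// [ltRHS]mulrC.
by rewrite mulrBr mulr1 mulrA; move: (b * c / _) => X; lra.
Qed.

End combinatorics.

(** * Volume in split coordinates *)

Section product_volume.
Context {R : realType} {d : nat}.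
Local Notation mR := (measurableTypeR R).
Local Notation V := 'rV[R]_d.
Implicit Types (L E H : {vspace V}) (A B : set V) (x : V).

Definition pair_coord E H (z : (\dim E).-tuple mR * (\dim H).-tuple mR) : V :=
  lincomb z.1 + lincomb z.2.

Definition product_vol E H A : \bar R :=
  (lebesgue_tuple (\dim E) \x lebesgue_tuple (\dim H))%E
    [set z | A (pair_coord z)].

Lemma measurable_pair_coord E H i :
  measurable_fun setT (fun z => @pair_coord E H z 0 i : mR).
Proof.
rewrite (_ : (fun z => _) = (fun z => lincomb z.1 0 i : mR) \+
                            (fun z => lincomb z.2 0 i)).
  apply: measurable_funD.
    exact: (measurableT_comp (@measurable_lincomb _ _ E i) measurable_fst).
  exact: (measurableT_comp (@measurable_lincomb _ _ H i) measurable_snd).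
by apply/funext => z; rewrite /= mxE.
Qed.

Lemma measurable_pair_coord_closed E H A : closed A ->
  measurable [set z | A (@pair_coord E H z)].
Proof. exact: (measurable_preimage_closed (@measurable_pair_coord E H)). Qed.

Lemma xsection_pair_coord E H A s :
  xsection [set z | A (@pair_coord E H z)] s =
  [set t | A (lincomb s + lincomb t)].
Proof.
by apply/seteqP; split => t /=; [move/xsectionP|move=> ?; apply/xsectionP].
Qed.

Lemma product_volE E H A :
  product_vol E H A =
  (\int[lebesgue_tuple (\dim E)]_s section_vol H A (lincomb (L := E) s))%E.
Proof.
rewrite /product_vol/= /product_measure1; apply: eq_integral => s _ /=.
by congr (lebesgue_tuple _ _); exact: xsection_pair_coord.
Qed.

Lemma measurable_section_vol E H A : closed A ->
  measurable_fun setT (fun s => section_vol H A (lincomb (L := E) s)).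
Proof.
move=> cA; have := measurable_fun_xsection (lebesgue_tuple (\dim H))
  (@measurable_pair_coord_closed E H A cA).
congr (measurable_fun _ _); apply/funext => s /=.
by congr (lebesgue_tuple _ _); exact: xsection_pair_coord.
Qed.

Lemma product_vol_shift E H A v : closed A -> (E + H = fullv)%VS ->
  (lebesgue_tuple (\dim E) \x lebesgue_tuple (\dim H))%E
    [set z | A (@pair_coord E H z + v)] = product_vol E H A.
Proof.
move=> cA EHT.
have : v \in (E + H)%VS by rewrite EHT memvf.
case/memv_addP => _ /lincomb_surj[s <-] [_ /lincomb_surj[t <-] ->].
rewrite /product_vol.
rewrite -[RHS](@product_measure_scaling _ _ _ _ R
   (lebesgue_tuple (\dim E)) (lebesgue_tuple (\dim H))
   (tuple_affine 1 s) (tuple_affine 1 t) 1 1)//.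
- rewrite mul1r mul1e; apply: congr1; apply/funext => z /=.
  by rewrite /pair_coord/= !lincomb_affine !scale1r addrACA.
- exact: measurable_tuple_affine.
- exact: measurable_tuple_affine.
- by move=> X mX; rewrite -[RHS](lebesgue_tuple_affine s ltr01)// expr1n.
- by move=> X mX; rewrite -[RHS](lebesgue_tuple_affine t ltr01)// expr1n.
- exact: measurable_pair_coord_closed.
Qed.

Lemma product_vol_le_shadow E H A B M : closed A -> closed B ->
  (forall s t, A (@pair_coord E H (s, t)) -> B (lincomb s)) ->
  (forall x, section_vol H A x <= M)%E ->
  (product_vol E H A <= section_vol E B 0 * M)%E.
Proof.
move=> cA cB AB AM.
have M0 : (0 <= M)%E by rewrite (le_trans _ (AM 0))// measure_ge0.
pose D := [set s | B (0 + lincomb (L := E) s)].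
have mD : measurable D.
  exact: (measurable_preimage_closed (measurable_add_lincomb 0)).
have -> : (section_vol E B 0 * M =
    \int[lebesgue_tuple (\dim E)]_s ((\1_D s)%:E * M))%E.
  by rewrite ge0_integralZr ?integral_indic ?setIT//; exact: measurableT_comp.
rewrite product_volE; apply: ge0_le_integral => //.
- exact: measurable_section_vol.
- apply: emeasurable_funM => //; exact: measurableT_comp.
move=> s _; rewrite indicE; have [sD|sD] := boolP (s \in D); first by rewrite mul1e.
rewrite mul0e /section_vol (_ : [set t | _] = set0) ?measure0//.
apply/seteqP; split => // t /= At.
by move: sD; rewrite notin_setE; apply; rewrite /D/= add0r; exact: AB At.
Qed.

Lemma convex_set_mem A x y (c u : R) : convex_set A -> 0 <= c -> 0 <= u -> c + u = 1 ->
  A x -> A y -> A (c *: x + u *: y).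
Proof.
move=> cvA c0 u0 cu Ax Ay.
have c01 : 0 <= c <= 1 by lra.
have := cvA x y (Itv01 c0 (proj2 (andP c01))) (mem_set Ax) (mem_set Ay).
rewrite inE /conv/= /unstable.onem.
by rewrite (_ : 1 - c = u)//; lra.
Qed.

(** A contains the image of its section over x by the homothety of ratio u centred
    at p, and this image lies in the section over c p + u x. *)
Lemma section_vol_convex H A p x (c u : R) : closed A -> convex_set A ->
  0 <= c -> 0 < u -> c + u = 1 -> A p ->
  ((u ^+ \dim H)%:E * section_vol H A x <= section_vol H A (c *: p + u *: x))%E.
Proof.
move=> cA cvA c0 u0 cu Ap.
have mS y := measurable_preimage_closed (@measurable_add_lincomb _ _ H y) cA.
rewrite -[leRHS](lebesgue_tuple_affine [tuple 0 | _ < \dim H] u0)//.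
rewrite lee_pmul2l ?lte_fin ?exprn_gt0//.
apply: le_measure; rewrite ?inE//; first exact: mS.
  rewrite -[X in measurable X]setTI; apply: measurable_tuple_affine => //; exact: mS.
move=> t /= At.
rewrite lincomb_affine (_ : lincomb [tuple 0 | _ < _] = 0) ?addr0.
  by rewrite -addrA -scalerDr; apply: convex_set_mem => //; exact: ltW.
by rewrite /lincomb big1// => i _; rewrite tnth_mktuple scale0r.
exact: mS.
Qed.

End product_volume.

(** * The Rogers-Shephard inequality *)

(** Only the partial sum up to the last j that satisfies P can contribute. *)
Lemma sum_weight_indic_le (R : realFieldType) n (w : nat -> R) (P : pred nat) (g : R) :
  (forall i, 0 <= w i) -> 0 <= g ->
  (forall j, (j < n)%N -> P j -> \sum_(i < j.+1) w i <= g) ->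
  \sum_(i < n) w i * (P i)%:R <= g.
Proof.
move=> w0 g0; elim: n => [|n ih] h; first by rewrite big_ord0.
case Pn : (P n); last first.
  rewrite big_ord_recr/= Pn mulr0 addr0; apply: ih => j jn.
  by apply: h; rewrite ltnS ltnW.
apply: le_trans (h n (ltnSn n) Pn); apply: ler_sum => i _.
by rewrite ler_piMr// lern1 leq_b1.
Qed.

(** A lower bound for a discrete version of the Beta integral
    k * int_0^1 u^(k-1) (1-u)^m du = 1 / binom(m + k, k): the weight of
    u = (i + 1) / (n + 1) is k! binom(i, k - 1) / (n + 1)^k, not an increment of
    u^k, because with it the sum is a convolution of binomial coefficients as soon
    as (n - i)^m is bounded below by a falling factorial. *)
Lemma beta_sum_ge (R : realFieldType) n m k : (0 < m)%N -> (0 < k)%N ->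
  1 - (m + k)%:R ^+ 2 / n.+1%:R <=
  'C(m + k, k)%:R * \sum_(i < n)
    (k`! * 'C(i, k.-1))%:R / n.+1%:R ^+ k * ((n - i)%:R / n.+1%:R) ^+ m :> R.
Proof.
move=> m0 k0; set N : R := n.+1%:R.
have N0 : 0 < N by rewrite ltr0n.
apply: (@le_trans _ _ ((n.+1 ^_ (m + k))%:R / N ^+ (m + k))).
  rewrite ler_pdivlMr ?exprn_gt0// -(ler_pM2l N0).
  apply: le_trans (ffact_ge_exp _ _ _); rewrite le_eqVlt; apply/orP; left; apply/eqP.
  rewrite -/N; field; exact: lt0r_neq0.
apply: (@le_trans _ _ ('C(m + k, k)%:R * \sum_(i < n)
    (k`! * 'C(i, k.-1) * (m`! * 'C(n - i, m)))%:R / N ^+ (m + k))).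
  rewrite -mulr_suml -natr_sum mulrA; apply: ler_wpM2r.
    by rewrite invr_ge0 exprn_ge0// ltW.
  rewrite -natrM ler_nat -bin_ffact.
  have := sum_bin_conv n k.-1 m; rewrite big_ord_recr/= subnn bin0n.
  rewrite (gtn_eqF m0) muln0 addn0 -addSn prednK// [(k + m)%N]addnC => <-.
  rewrite -(bin_fact (leq_addl m k)) addnK.
  rewrite big_distrl big_distrr/= leq_sum// => i _.
  by rewrite leq_eqVlt; apply/orP; left; apply/eqP; ring.
rewrite ler_wpM2l// ler_sum// => i _.
rewrite expr_div_n [leRHS]mulrACA -invfM -exprD [(k + m)%N]addnC.
apply: ler_wpM2r; first by rewrite invr_ge0 exprn_ge0// ltW.
rewrite natrM; apply: ler_wpM2l => //; rewrite -natrX ler_nat.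
by rewrite mulnC bin_ffact ffact_leq_exp.
Qed.

Section rogers_shephard.
Context {R : realType} {d : nat}.
Local Notation mR := (measurableTypeR R).
Local Notation V := 'rV[R]_d.
Implicit Types (L E H : {vspace V}) (A B : set V) (x : V).

Lemma homothety_vol n (c : R) (w : n.-tuple mR) (X : set (n.-tuple mR)) (v : R) :
  0 < c -> measurable X -> lebesgue_tuple n X = v%:E ->
  lebesgue_tuple n (tuple_affine c^-1 w @^-1` X) = (c ^+ n * v)%:E.
Proof.
move=> c0 mX Xv; have ci : 0 < c^-1 by rewrite invr_gt0.
have := lebesgue_tuple_affine w ci mX; rewrite Xv.
move=> /(congr1 (fun y => (c ^+ n)%:E * y)%E).
by rewrite muleA -!EFinM -exprMn mulfV ?lt0r_neq0// expr1n mul1e.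
Qed.

(** Let X be the shadow in coordinates, u = (i + 1) / (n + 1) and c = 1 - u.  On
    the homothetic copy D i = c X + u s0 of X the sections have volume at least
    u^k M.  The weights w satisfy w 0 + ... + w i <= u^k, so that M times the step
    function with weights w on the sets D i lies below the volume of the section;
    the step function is integrated by [homothety_vol]. *)
Lemma rogers_shephard_discrete E H A B s0 n :
  (0 < \dim E)%N -> (0 < \dim H)%N ->
  closed A -> bounded_set A -> convex_set A -> closed B -> bounded_set B ->
  (forall s, B (lincomb s) -> exists t, A (@pair_coord R d E H (s, t))) ->
  ((fine (section_vol E B 0) * fine (section_vol H A (lincomb (L := E) s0)) *
     \sum_(i < n) ((\dim H)`! * 'C(i, (\dim H).-1))%:R / n.+1%:R ^+ \dim H *
                  ((n - i)%:R / n.+1%:R) ^+ \dim E)%:E <= product_vol E H A)%E.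
Proof.
move=> m0 k0 cA bA cvA cB bB BA.
set m := \dim E; set k := \dim H.
set vB := fine (section_vol E B 0); set M := fine (section_vol H A _).
have vBE : section_vol E B 0 = vB%:E by rewrite /vB fineK// section_vol_fin_num.
have ME : section_vol H A (lincomb (L := E) s0) = M%:E.
  by rewrite /M fineK// section_vol_fin_num.
have M0 : 0 <= M by rewrite -lee_fin -ME measure_ge0.
set N : R := n.+1%:R; have N0 : 0 < N by rewrite ltr0n.
pose X := [set s | B (0 + lincomb (L := E) s)].
have mX : measurable X by exact: (measurable_preimage_closed (measurable_add_lincomb 0)).
pose c (i : nat) : R := (n - i)%:R / N.
pose u (i : nat) : R := i.+1%:R / N.
(* The affine map is the inverse of s |-> c s + u s0. *)
pose D i := tuple_affine (c i)^-1 [tuple - (u i / c i) * tnth s0 j | j < m] @^-1` X.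
pose w (i : nat) : R := (k`! * 'C(i, k.-1))%:R / N ^+ k.
have c0 i : (i < n)%N -> 0 < c i by move=> i_lt; rewrite divr_gt0// ltr0n subn_gt0.
have cu i : (i < n)%N -> c i + u i = 1.
  move=> i_lt; rewrite /c /u -mulrDl -natrD addnS subnK ?(ltnW i_lt)//.
  by rewrite divff// lt0r_neq0.
have mD i : measurable (D i).
  by rewrite -[X in measurable X]setTI; apply: measurable_tuple_affine.
have w0 i : 0 <= w i by rewrite divr_ge0// exprn_ge0// ltW.
have sum_w j : \sum_(i < j.+1) w i <= u j ^+ k.
  rewrite /w -mulr_suml -natr_sum -big_distrr/= sum_bin prednK//.
  rewrite expr_div_n ler_wpM2r ?invr_ge0 ?exprn_ge0// ?(ltW N0)//.
  by rewrite -natrX ler_nat mulnC bin_ffact ffact_leq_exp.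
have sec_ge i s : (i < n)%N -> D i s ->
    ((u i ^+ k * M)%:E <= section_vol H A (lincomb (L := E) s))%E.
  move=> i_lt; rewrite /D/X/= add0r => /BA[t At].
  have u0 : 0 < u i by rewrite divr_gt0// ltr0n.
  have := @section_vol_convex _ _ H A _ (lincomb s0) (c i) (u i) cA cvA
    (ltW (c0 i i_lt)) u0 (cu i i_lt) At.
  rewrite ME -EFinM => /le_trans; apply.
  rewrite le_eqVlt; apply/orP; left; apply/eqP.
  rewrite -(@section_vol_shift _ _ H A (lincomb s) (c i *: lincomb t) cA); last first.
    by apply: memvZ; exact: mem_lincomb.
  congr (section_vol _ _ _).
  rewrite /pair_coord/= lincomb_affine.
  have -> : lincomb [tuple - (u i / c i) * tnth s0 j | j < m] =
      - (u i / c i) *: lincomb s0.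
    rewrite /lincomb scaler_sumr; apply: eq_bigr => j _.
    by rewrite tnth_mktuple scalerA.
  have ci0 : c i != 0 by rewrite lt0r_neq0// c0.
  rewrite !scalerDr !scalerA mulrN mulfV// scale1r mulrCA mulfV// mulr1.
  by rewrite scaleNr [X in X + _]addrAC subrK.
rewrite product_volE.
apply: (@le_trans _ _ (\int[lebesgue_tuple m]_s
    (\sum_(i < n) (w i * M)%:E * (\1_(D i) s)%:E)))%E; last first.
  apply: ge0_le_integral => //.
  - by move=> s _; apply: sume_ge0 => i _; rewrite mule_ge0// lee_fin mulr_ge0.
  - apply: emeasurable_sum => i; apply: emeasurable_funM => //.
    exact: measurableT_comp.
  - exact: measurable_section_vol.
  move=> s _.
  have fs : section_vol H A (lincomb (L := E) s) \is a fin_num by exact: section_vol_fin_num.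
  rewrite -(fineK fs); under eq_bigr do rewrite -EFinM indicE.
  rewrite sumEFin lee_fin.
  apply: (@sum_weight_indic_le _ n (fun i => w i * M) (fun i => s \in D i)).
  - by move=> i; rewrite mulr_ge0.
  - by rewrite fine_ge0// measure_ge0.
  move=> j jn sDj; rewrite -mulr_suml -lee_fin fineK//.
  apply: le_trans (sec_ge j s jn _); last by rewrite inE in sDj.
  by rewrite lee_fin ler_wpM2r.
rewrite ge0_integral_sum//; first last.
- by move=> i s _; rewrite mule_ge0// lee_fin mulr_ge0.
- move=> i; apply: emeasurable_funM => //.
  by apply/measurable_EFinP; exact: measurable_indic.
rewrite mulr_sumr -sumEFin le_eqVlt; apply/orP; left; apply/eqP.
apply: eq_bigr => i _.
have wM0 : (0 <= (w i * M)%:E)%E by rewrite lee_fin; exact: mulr_ge0.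
rewrite ge0_integralZl//; last exact: measurableT_comp.
rewrite integral_indic// setIT.
have Di : lebesgue_tuple m (D i) = (c i ^+ m * vB)%:E.
  by apply: homothety_vol => //; exact: c0.
transitivity ((w i * M)%:E * (c i ^+ m * vB)%:E)%E; last by congr (_ * _)%E.
by rewrite -EFinM; congr EFin; rewrite /w /c; ring.
Qed.

Lemma rogers_shephard E H A B s0 :
  (0 < \dim E)%N -> (0 < \dim H)%N ->
  closed A -> bounded_set A -> convex_set A -> closed B -> bounded_set B ->
  (forall s, B (lincomb s) -> exists t, A (@pair_coord R d E H (s, t))) ->
  (section_vol E B 0 * section_vol H A (lincomb (L := E) s0) <=
   'C(\dim E + \dim H, \dim H)%:R%:E * product_vol E H A)%E.
Proof.
move=> m0 k0 cA bA cvA cB bB BA.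
set m := \dim E; set k := \dim H.
have vBE := section_vol_fin_num E 0 cB bB.
have ME := section_vol_fin_num H (lincomb (L := E) s0) cA bA.
rewrite -(fineK vBE) -(fineK ME) -EFinM.
have b0 : 0 <= fine (section_vol E B 0) * fine (section_vol H A (lincomb (L := E) s0)).
  by rewrite mulr_ge0// fine_ge0// measure_ge0.
apply: (@le_of_le_vanishing _ _ ((m + k)%:R ^+ 2)) => // n.
have /(lee_wpmul2l (_ : 0 <= 'C(m + k, k)%:R%:E)%E) :=
  @rogers_shephard_discrete E H A B s0 n m0 k0 cA bA cvA cB bB BA.
rewrite lee_fin => /(_ (ler0n _ _)); apply: le_trans.
rewrite -EFinM lee_fin mulrCA; apply: ler_wpM2l => //.
exact: beta_sum_ge.
Qed.

End rogers_shephard.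

(** * Volume of bodies and of packings *)

Section body_volume.
Context {R : realType} {d : nat}.
Local Notation mR := (measurableTypeR R).
Local Notation V := 'rV[R]_d.
Implicit Types (A C K : set V) (x : V).

Definition body_vol A : \bar R := lebesgue_tuple d [set t | A (row_of_tuple t)].

Lemma measurable_row_of_tuple_closed A : closed A ->
  measurable [set t : d.-tuple mR | A (row_of_tuple t)].
Proof. exact: (measurable_preimage_closed (@measurable_row_of_tuple R d)). Qed.

Lemma body_vol_fin_num A : closed A -> bounded_set A -> body_vol A \is a fin_num.
Proof.
move=> cA [M [_ hM]]; rewrite ge0_fin_numE ?measure_ge0//.
rewrite (@le_lt_trans _ _ (lebesgue_tuple d (cube d (`|M| + 1))))//; last first.
  by rewrite lebesgue_tuple_cube ?ltry// addr_ge0.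
apply: le_measure; rewrite ?inE//;
  [exact: measurable_row_of_tuple_closed|exact: measurable_cube|].
move=> t /= At i; have <- : row_of_tuple t 0 i = tnth t i by rewrite mxE.
rewrite (le_trans (mx_coord_le_norm _ _))// hM//.
by rewrite (le_lt_trans (ler_norm _))// ltrDl.
Qed.

Lemma body_vol_gt0 A : closed A -> A° !=set0 -> (0 < body_vol A)%E.
Proof.
move=> cA [x /nbhs_ballP[e /= e0 eA]].
rewrite /body_vol -(lebesgue_tuple_shift x cA).
apply: (@lt_le_trans _ _ (lebesgue_tuple d (cube d (e / 2)))).
  by rewrite lebesgue_tuple_cube ?divr_ge0 ?ltW// lte_fin exprn_gt0// mulr_gt0// divr_gt0.
apply: le_measure; rewrite ?inE//; [exact: measurable_cube| |].
  exact: (measurable_row_of_tuple_closed (closed_shift cA)).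
move=> t /= te; apply: eA; split => // a i; rewrite (ord1 a) !mxE /ball/=.
rewrite distrC addrK (le_lt_trans (te i))//; lra.
Qed.

Lemma interior_homothety C x0 z (s : R) : convex_set C -> C° x0 -> C z ->
  0 < s -> s < 1 -> C° ((1 - s) *: x0 + s *: z).
Proof.
move=> cvC /nbhs_ballP[e /= e0 eC] Cz s0 s1; have s1' : 0 < 1 - s by lra.
apply/nbhs_ballP; exists ((1 - s) * e) => /=; first exact: mulr_gt0.
move=> y; rewrite -ball_normE/= => xy.
pose p := x0 - (1 - s)^-1 *: ((1 - s) *: x0 + s *: z - y).
have -> : y = (1 - s) *: p + s *: z.
  rewrite /p scalerBr scalerA mulfV ?lt0r_neq0// scale1r.
  by rewrite !opprD opprK !addrA subrr add0r addrAC addNr add0r.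
apply: convex_set_mem => //; [exact: ltW|exact: ltW|lra|].
apply: eC; rewrite -ball_normE/= opprB addrC subrK normrZ gtr0_norm ?invr_gt0//.
by rewrite mulrC ltr_pdivrMr// mulrC.
Qed.

Lemma bernoulli_ineq (n : nat) (y : R) : 0 <= y -> y <= 1 -> 1 - n%:R * y <= (1 - y) ^+ n.
Proof.
move=> y0 y1; elim: n => [|n ih]; first by rewrite mul0r subr0.
rewrite exprS; have := ler0n R n; rewrite -natr1 => n0.
have y1' : 0 <= 1 - y by lra.
apply: le_trans (ler_wpM2l y1' ih).
rewrite -subr_ge0 (_ : _ - _ = n%:R * y * y); first by rewrite !mulr_ge0.
ring.
Qed.

(** The homothetic copy of C of ratio s < 1 centred at an interior point lies in
    the interior of C and has volume s^d vol C; let s tend to 1. *)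
Lemma body_vol_interior C : closed C -> bounded_set C -> convex_set C -> C° !=set0 ->
  (body_vol C <= body_vol C°)%E.
Proof.
move=> cC bC cvC [x0 Cx0].
have Cfin := body_vol_fin_num cC bC.
have C0 : 0 <= fine (body_vol C) by rewrite fine_ge0// measure_ge0.
rewrite -(fineK Cfin); apply: (@le_of_le_vanishing _ _ d%:R) => // n.
pose s : R := 1 - n.+2%:R^-1.
have n2 : (0 : R) < n.+2%:R^-1 by rewrite invr_gt0.
have n2' : n.+2%:R^-1 < 1 :> R by rewrite invf_lt1// ltr1n.
have s0 : 0 < s by rewrite subr_gt0.
have s1 : s < 1 by rewrite gtrBl.
(* t |-> s^-1 t + w is the inverse of the homothety t |-> x0 + s (t - x0). *)
pose w := [tuple ((1 - s^-1) *: x0) 0 i | i < d].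
have hs := homothety_vol w s0 (measurable_row_of_tuple_closed cC) (esym (fineK Cfin)).
apply: (@le_trans _ _ (s ^+ d * fine (body_vol C))%:E).
  rewrite lee_fin mulrC; apply: ler_wpM2r => //.
  apply: le_trans (bernoulli_ineq d (ltW n2) (ltW n2')).
  by rewrite lerD2l lerN2 ler_wpM2l// lef_pV2 ?posrE// ler_nat.
rewrite -hs; apply: le_measure; rewrite ?inE.
- rewrite -[X in measurable X]setTI; apply: measurable_tuple_affine => //.
  exact: measurable_row_of_tuple_closed.
- apply: (measurable_preimage_open (@measurable_row_of_tuple R d)); exact: open_interior.
move=> t /=; rewrite row_of_tuple_affine => Ct.
have := interior_homothety cvC Cx0 Ct s0 s1.
rewrite scalerDr !scalerA mulfV ?lt0r_neq0// scale1r addrCA -scalerDl.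
by rewrite mulrBr mulr1 mulfV ?lt0r_neq0// addrA subrK subrr scale0r addr0.
Qed.

Lemma fold_packing_vol (N r : nat) K (C : 'I_N -> set V) : closed K ->
  (forall i, C i `<=` K) ->
  (forall x, K x -> (#|[pred i | `[< (C i)° x >]]| <= r)%N) ->
  (\sum_(i < N) body_vol (C i)° <= r%:R%:E * body_vol K)%E.
Proof.
move=> cK CK pack.
pose X i := [set t : d.-tuple mR | (C i)° (row_of_tuple t)].
have mX i : measurable (X i).
  apply: (measurable_preimage_open (@measurable_row_of_tuple R d)); exact: open_interior.
have mK := measurable_row_of_tuple_closed cK.
rewrite (_ : (r%:R%:E * body_vol K)%E =
   (\int[lebesgue_tuple d]_t
     (r%:R%:E * (\1_[set t | K (row_of_tuple t)] t)%:E))%E); last first.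
  by rewrite ge0_integralZl ?integral_indic ?setIT//; exact: measurableT_comp.
rewrite (eq_bigr (fun i => \int[lebesgue_tuple d]_t (\1_(X i) t)%:E))%E; last first.
  by move=> i _; rewrite integral_indic ?setIT.
rewrite -ge0_integral_sum//; last by move=> i; exact: measurableT_comp.
apply: ge0_le_integral => //.
- by move=> t _; exact: sume_ge0.
- by apply: emeasurable_sum => i; exact: measurableT_comp.
- by apply: emeasurable_funM => //; exact: measurableT_comp.
move=> t _; rewrite sumEFin -EFinM lee_fin indicE.
have [tK|tK] := boolP (t \in _).
  rewrite mulr1; rewrite inE/= in tK.
  apply: le_trans
    (_ : #|[pred i | `[< (C i)° (row_of_tuple t) >]]|%:R <= _).
    rewrite -sum1_card natr_sum [leRHS]big_mkcond/= ler_sum// => i _.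
    by rewrite indicE inE; case: asboolP => [h|h]; [rewrite mem_set|rewrite memNset].
  by rewrite ler_nat; exact: pack.
rewrite mulr0 big1// => i _; rewrite indicE memNset// => /interior_subset /CK.
by move: tK; rewrite notin_setE.
Qed.

End body_volume.

(** * Cylinders *)

Section product_sigma_finite.
Context d1 d2 (T1 : measurableType d1) (T2 : measurableType d2) (R : realType).
Variables (m1 : {sigma_finite_measure set T1 -> \bar R})
  (m2 : {sigma_finite_measure set T2 -> \bar R}).

(** A name for the product measure to which its sigma-finiteness can be attached as
    a canonical structure. *)
Definition sigma_finite_product : set (T1 * T2) -> \bar R := (m1 \x m2)%E.

HB.instance Definition _ := Measure.on sigma_finite_product.

Let sigma_finite_product_subproof : sigma_finite setT sigma_finite_product.
Proof.
have /sigma_finiteP[F [FT ndF Ffin]] := sigma_finiteT m1.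
have /sigma_finiteP[G [GT ndG Gfin]] := sigma_finiteT m2.
exists (fun n => F n `*` G n) => [|n]; last first.
  have [[mF F_lt] [mG G_lt]] := (Ffin n, Gfin n); split; first exact: measurableX.
  by rewrite /sigma_finite_product product_measure1E// lte_mul_pinfty// ge0_fin_numE.
apply/seteqP; split => // -[x y] _.
have [i _ Fx] : (\bigcup_i F i) x by rewrite -FT.
have [j _ Gy] : (\bigcup_j G j) y by rewrite -GT.
exists (maxn i j) => //; split => /=.
  by have /subsetPset := ndF _ _ (leq_maxl i j); exact.
by have /subsetPset := ndG _ _ (leq_maxr i j); exact.
Qed.

HB.instance Definition _ := Measure_isSigmaFinite.Build _ _ _ sigma_finite_product
  sigma_finite_product_subproof.

End product_sigma_finite.

Section product_vs_body_volume.
Context {R : realType} {d : nat}.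
Local Notation mR := (measurableTypeR R).
Local Notation V := 'rV[R]_d.
Implicit Types (E H : {vspace V}) (A K : set V).

Lemma product_vol_proportional E H A K : (E + H = fullv)%VS ->
  closed A -> closed K -> bounded_set K -> K° !=set0 ->
  (body_vol A * product_vol E H K = body_vol K * product_vol E H A)%E.
Proof.
move=> EH cA cK bK K0.
pose lam : {sigma_finite_measure set _ -> \bar R} :=
  sigma_finite_product (lebesgue_tuple (\dim E)) (lebesgue_tuple (\dim H)).
have shiftE (D : set V) v : closed D ->
    lam [set z | D (@pair_coord R d E H z + v)] =
    lam [set z | D (@pair_coord R d E H z)].
  by move=> cD; exact: product_vol_shift.
exact: (@shift_invariant_proportional R _ _ d lam (@pair_coord R d E H) A K
  (@measurable_pair_coord R d E H) shiftE cA cK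
  (body_vol_fin_num cK bK) (body_vol_gt0 cK K0)).
Qed.

(** By proportionality, a body of measure 0 would make the measure of the whole
    space 0, although it contains a cube. *)
Lemma product_vol_gt0 E H K : (E + H = fullv)%VS ->
  closed K -> bounded_set K -> K° !=set0 -> (0 < product_vol E H K)%E.
Proof.
move=> EH cK bK K0.
have cube_gt0 n : (0 < lebesgue_tuple n (cube n (1 : R)))%E.
  by rewrite lebesgue_tuple_cube// lte_fin exprn_gt0// mulr_gt0.
have T0 : (0 < product_vol E H setT)%E.
  pose Q := cube (\dim E) (1 : R) `*` cube (\dim H) (1 : R).
  apply: (@lt_le_trans _ _ ((lebesgue_tuple (\dim E) \x lebesgue_tuple (\dim H))%E Q)).
    rewrite product_measure1E; [|exact: measurable_cube|exact: measurable_cube].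
    by apply: mule_gt0; exact: cube_gt0.
  apply: le_measure; rewrite ?inE//; last exact: measurable_pair_coord_closed closedT.
  by apply: measurableX; exact: measurable_cube.
have := product_vol_proportional EH closedT cK bK K0 => eq.
rewrite lt0e measure_ge0 andbT; apply/eqP => K00; move: eq; rewrite K00 mule0.
apply/eqP; rewrite lt_eqF// mule_gt0//; exact: body_vol_gt0.
Qed.

End product_vs_body_volume.

Lemma crossection_ratio_le (R : realFieldType) (b p mC mK nC nK vC vK q : R) :
  0 < mC -> 0 < nK -> 0 < vK -> 0 <= nC -> 0 < mK -> 0 <= q ->
  b * mC <= q * nC -> nK <= p * mK -> vC * nK = vK * nC ->
  b / p <= q * (vC / vK) * (mK / mC).
Proof.
move=> mC0 nK0 vK0 nC0 mK0 q0 h1 h2 h3.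
have p0 : 0 < p by rewrite -(pmulr_lgt0 _ mK0) (lt_le_trans nK0).
rewrite ler_pdivrMr//.
have -> : vC / vK = nC / nK by apply/eqP; rewrite eqr_div ?lt0r_neq0// h3 mulrC.
apply: (@le_trans _ _ (q * nC / mC)); first by rewrite ler_pdivlMr.
have -> : q * (nC / nK) * (mK / mC) * p = q * nC / mC * ((p * mK) / nK).
  by field; rewrite !lt0r_neq0.
rewrite ler_peMr ?mulr_ge0 ?invr_ge0 ?(ltW mC0)//.
by rewrite ler_pdivlMr// mul1r.
Qed.

Section cylinder.
Context {R : realType} {d : nat}.
Local Notation mR := (measurableTypeR R).
Local Notation V := 'rV[R]_d.
Implicit Types (E H : {vspace V}) (A B K : set V).

Lemma orthoproj_pair_coord H s t :
  orthoproj (orthocompl H) (@pair_coord R d (orthocompl H) H (s, t)) = lincomb s.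
Proof. by rewrite orthoproj_split// mem_lincomb. Qed.

Lemma pair_coord_surj H (x : V) :
  exists z, @pair_coord R d (orthocompl H) H z = x.
Proof.
have : x \in (H + orthocompl H)%VS by rewrite orthocompl_addv memvf.
case/memv_addP => _ /lincomb_surj[t <-] [_ /lincomb_surj[s <-] ->].
by exists (s, t); rewrite /pair_coord addrC.
Qed.

Lemma orthoproj_cylinder K B H :
  B `<=` [set` orthocompl H] -> B `<=` orthoproj (orthocompl H) @` K ->
  orthoproj (orthocompl H) @` (cylinder B H `&` K) = B.
Proof.
move=> BE BK; apply/seteqP; split => [_ [x [[b Bb [h hH <-]] _] <-]|b Bb].
  by rewrite orthoproj_split//; exact: BE.
have [x Kx xb] := BK b Bb; exists x => //; split => //.
have [[s t] xE] := pair_coord_surj H x.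
exists b => //; exists (lincomb t); first exact: mem_lincomb.
by rewrite -xb -xE orthoproj_pair_coord.
Qed.

Lemma compact_orthoproj E A : compact A -> compact (orthoproj E @` A).
Proof.
move=> cptA; apply: continuous_compact => //.
exact: (continuous_subspaceT (@linear_rV_continuous R d 'rV[R]_d (orthoproj E))).
Qed.

Lemma section_vols_max H A a : closed A ->
  (forall x, section_vol H A x <= section_vol H A a)%E ->
  is_max (section_vols A H) (section_vol H A a).
Proof.
move=> cA amax; split; first by exists a => //; exact: flat_vol_section.
by move=> _ [x _ <-]; rewrite flat_vol_section.
Qed.

(** Fubini from above and Rogers-Shephard from below.  Stated with real numbers,
    since positivity and finiteness are what makes the divisions in the
    crossectional volume harmless. *)
Lemma shadow_section_bounds H A :
  (0 < \dim H)%N -> (\dim H < d)%N -> convex_body A ->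
  exists M p n : R,
   [/\ is_max (section_vols A H) M%:E,
       subspace_vol (orthocompl H) (orthoproj (orthocompl H) @` A) = p%:E,
       product_vol (orthocompl H) H A = n%:E,
       0 < M /\ 0 < n &
       n <= p * M /\ p * M <= 'C(d, \dim H)%:R * n].
Proof.
move=> k0 kd [cptA cvA A0]; set E := orthocompl H.
have dimEH : (\dim E + \dim H = d)%N.
  rewrite addnC -dimv_disjoint_sum ?orthocompl_capv// orthocompl_addv dimvf.
  by rewrite /dim/= mul1n.
have EH : (E + H = fullv)%VS by rewrite addvC orthocompl_addv.
have cA := compact_closed (@norm_hausdorff _ _) cptA.
have bA := compact_bounded cptA.
have cptP := compact_orthoproj (E := E) cptA.
have cP := compact_closed (@norm_hausdorff _ _) cptP.
have bP := compact_bounded cptP.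
have [a Aa amax] : exists2 a, A a & forall x, (section_vol H A x <= section_vol H A a)%E.
  by apply: section_vol_max => //; case: A0 => x /interior_subset Ax; exists x.
have Mfin := section_vol_fin_num H a cA bA.
have le1 : (product_vol E H A <=
    section_vol E (orthoproj E @` A) 0 * section_vol H A a)%E.
  apply: product_vol_le_shadow => // s t At; exists (pair_coord (s, t)) => //.
  exact: orthoproj_pair_coord.
have le2 : (section_vol E (orthoproj E @` A) 0 * section_vol H A a <=
    'C(d, \dim H)%:R%:E * product_vol E H A)%E.
  (* Rogers-Shephard is about sections over points of E: move a there along H. *)
  have [[s0 t0] aE] := pair_coord_surj H a.
  have -> : section_vol H A a = section_vol H A (lincomb s0).
    by rewrite -aE section_vol_shift// mem_lincomb.
  suff : (section_vol E (orthoproj E @` A) 0 * section_vol H A (lincomb s0) <=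
      'C(\dim E + \dim H, \dim H)%:R%:E * product_vol E H A)%E by rewrite dimEH.
  apply: rogers_shephard => //.
    by rewrite -(ltn_add2r (\dim H)) dimEH.
  move=> s [x Ax xs]; have [[s' t'] xE] := pair_coord_surj H x.
  exists t'; rewrite /pair_coord/= -xs -xE orthoproj_pair_coord.
  by move: xE; rewrite /pair_coord/= => ->.
have n0 := product_vol_gt0 EH cA bA A0.
have pfin := section_vol_fin_num E 0 cP bP.
have nfin : product_vol E H A \is a fin_num.
  rewrite ge0_fin_numE ?ltW// (le_lt_trans le1)// -ge0_fin_numE ?fin_numM//.
  by rewrite mule_ge0// measure_ge0.
have amaxE := section_vols_max cA amax.
move: le1 le2 amaxE n0; rewrite -(fineK Mfin) -(fineK pfin) -(fineK nfin).
rewrite -!EFinM !lee_fin lte_fin.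
set M := fine (section_vol H A a); set p := fine (section_vol E _ 0).
set n := fine (product_vol E H A) => le1 le2 amaxE n0.
exists M, p, n; split => //.
  by rewrite subspace_vol_closed// /p fineK.
split => //; rewrite lt_neqAle fine_ge0 ?measure_ge0// andbT.
by apply: contraTneq (lt_le_trans n0 le1) => <-; rewrite mulr0 ltxx.
Qed.

(** [shadow_section_bounds] is used for K from above and for the body cut out by the
    cylinder from below; [product_vol_proportional] then replaces the measure that
    depends on H by the volume of R^d, for which the cylinders can be compared. *)
Lemma crv_cylinder_le K B H :
  (0 < \dim H)%N -> (\dim H < d)%N -> convex_body K ->
  B `<=` [set` orthocompl H] -> B `<=` orthoproj (orthocompl H) @` K ->
  convex_body (cylinder B H `&` K) ->
  exists MK MC : \bar R,
   [/\ is_max (section_vols K H) MK,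
       is_max (section_vols (cylinder B H `&` K) H) MC &
       (crv K B H <= ('C(d, \dim H)%:R *
         (fine (body_vol (cylinder B H `&` K)) / fine (body_vol K)))%:E * (MK / MC))%E].
Proof.
move=> k0 kd bodyK BE BK bodyC; set C := cylinder B H `&` K.
have [mK [p [nK [maxK pE nKE [mK0 nK0] [nK_le _]]]]] :=
  shadow_section_bounds k0 kd bodyK.
have [mC [b [nC [maxC bE nCE [mC0 nC0] [_ b_le]]]]] :=
  shadow_section_bounds k0 kd bodyC.
rewrite orthoproj_cylinder// in bE.
exists mK%:E, mC%:E.
have qE : (mK%:E / mC%:E)%E = (mK / mC)%:E by rewrite inver gt_eqF.
have p0 : 0 < p by rewrite -(pmulr_lgt0 _ mK0) (lt_le_trans nK0).
split => //.
rewrite qE /crv bE pE inver gt_eqF// -!EFinM lee_fin.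
have [[cptK _ K0] [cptC _ _]] := (bodyK, bodyC).
have cK := compact_closed (@norm_hausdorff _ _) cptK.
have cC := compact_closed (@norm_hausdorff _ _) cptC.
have EH : (orthocompl H + H = fullv)%VS by rewrite addvC orthocompl_addv.
have vKfin := body_vol_fin_num cK (compact_bounded cptK).
have vCfin := body_vol_fin_num cC (compact_bounded cptC).
apply: (@crossection_ratio_le _ b p mC mK nC nK) => //; [|exact: ltW|].
  by rewrite -lte_fin fineK// body_vol_gt0.
have := product_vol_proportional EH cC cK (compact_bounded cptK) K0.
by rewrite nKE nCE -(fineK vKfin) -(fineK vCfin) -!EFinM => -[].
Qed.

End cylinder.

Theorem theorem4p6 (R : realType) (d k r N : nat) (K : set 'rV[R]_d)
  (B : 'I_N -> set 'rV[R]_d) (H : 'I_N -> {vspace 'rV[R]_d})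
  (k_gt0 : (0 < k)%N) (k_lt_d : (k < d)%N) (r_ge1 : (1 <= r)%N)
  (K_body : convex_body K)
  (C_cyl : forall i, is_cylinder k (B i) (H i))
  (C_pack : fold_packing r K B H)
  (Cbar_body : forall i, convex_body (cylinder (B i) (H i) `&` K)) :
  exists MK MC : 'I_N -> \bar R,
    [/\ forall i, is_max (section_vols K (H i)) (MK i),
        forall i, is_max (section_vols (cylinder (B i) (H i) `&` K) (H i)) (MC i) &
        (\sum_(i < N) crv K (B i) (H i) <=
         r%:R%:E * 'C(d, k)%:R%:E * \big[maxe/0]_(i < N) (MK i / MC i))%E].
Proof.
have dimH i : \dim (H i) = k by case: (C_cyl i).
have [BK pack] := C_pack.
pose C i := cylinder (B i) (H i) `&` K.
pose ratio i := fine (body_vol (C i)) / fine (body_vol K).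
have /choice[MM hMM] : forall i, exists M : \bar R * \bar R,
   [/\ is_max (section_vols K (H i)) M.1, is_max (section_vols (C i) (H i)) M.2 &
       (crv K (B i) (H i) <= ('C(d, k)%:R * ratio i)%:E * (M.1 / M.2))%E].
  move=> i; have [|||||| MK [MC h]] := @crv_cylinder_le R d K (B i) (H i).
  - by rewrite dimH.
  - by rewrite dimH.
  - exact: K_body.
  - by case: (C_cyl i) => _ [].
  - exact: BK.
  - exact: Cbar_body.
  by exists (MK, MC); rewrite dimH in h.
exists (fun i => (MM i).1), (fun i => (MM i).2).
split => [i|i|]; [by case: (hMM i)|by case: (hMM i)|].
set q := \big[maxe/0%E]_i _.
have q0 : (0 <= q)%E by rewrite /q; exact: bigmax_ge_id.
have [cptK _ K0] := K_body.
have cK := compact_closed (@norm_hausdorff _ _) cptK.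
have vKfin := body_vol_fin_num cK (compact_bounded cptK).
have vK0 : 0 < fine (body_vol K) by rewrite -lte_fin fineK// body_vol_gt0.
have ratio0 i : 0 <= ratio i by rewrite divr_ge0// ?fine_ge0// ?measure_ge0// ltW.
have ratio_sum : \sum_(i < N) ratio i <= r%:R.
  rewrite -mulr_suml ler_pdivrMr// -lee_fin -sumEFin EFinM fineK//.
  apply: le_trans (fold_packing_vol cK (fun i => @subIsetr _ _ K) pack).
  apply: lee_sum => i _; have [cptC cvC C0] := Cbar_body i.
  have cC := compact_closed (@norm_hausdorff _ _) cptC.
  have bC := compact_bounded cptC.
  by rewrite fineK ?body_vol_fin_num//; exact: body_vol_interior.
apply: (@le_trans _ _ (\sum_(i < N) ('C(d, k)%:R * ratio i)%:E * q)%E).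
  apply: lee_sum => i _; have [_ _ /le_trans] := hMM i; apply.
  apply: lee_wpmul2l; first by rewrite lee_fin mulr_ge0.
  exact: (le_bigmax _ (fun i => (MM i).1 / (MM i).2)%E).
rewrite -ge0_sume_distrl; last by move=> i _; rewrite lee_fin mulr_ge0.
apply: lee_wpmul2r => //.
by rewrite sumEFin -mulr_sumr -EFinM lee_fin mulrC ler_wpM2r.
Qed.
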